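(* Let $L$ be a line in $\mathbb{K}P^3$ such that $L\cap Q(\mathbb{K})$ consists of a single point. Then $\operatorname{VAL}(L)$ is equal to one of the following two sets: (i) $\{r\}\times\sigma(l\setminus\{p\})\ \cup\ ((r,\infty)\cap\mathbb{Q})\times\mathcal{S}|_{\{p\}}\ \cup\ \{\infty\}\times\{p\}$, where $r>0$, $l$ is a line contained in $Q(\mathbb{C})$, $p\in l$, and $\sigma$ is a section of $\mathcal{S}$ over $l\setminus\{p\}$; or (ii) $\{0\}\times\varkappa^\circ(l\setminus\{p\})\ \cup\ ((0,\infty)\cap\mathbb{Q})\times\mathcal{S}|_{\{p\}}\ \cup\ \{\infty\}\times\{p\}$, where $l$ is a line in $\mathbb{C}P^3$ tangent to $Q(\mathbb{C})$ at the point $p$.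
   Context: Matrices and classes. For a $2\times 2$ matrix $B=\begin{pmatrix}a&b\\ c&d\end{pmatrix}$ write $B^{\mathbf c}=\begin{pmatrix}d&-b\\ -c&a\end{pmatrix}$; $B^*$ is the conjugate transpose. $\mathbb{C}P^3$ is the projectivization of the space of complex $2\times2$ matrices; $[B]_{\mathbb{C}^*}$ is the class of a nonzero matrix up to nonzero complex scalars, $[B]_{\mathbb{R}^*}$ its class up to nonzero real scalars. $Q(\mathbb{C})=\{[B]_{\mathbb{C}^*}:\det B=0\}$, $PSL_2(\mathbb{C})=\mathbb{C}P^3\setminus Q(\mathbb{C})$, $PSU(2)=\{[U]_{\mathbb{C}^*}:U\in SU(2)\}$. The spherical coamoeba map $\varkappa^\circ\colon PSL_2(\mathbb{C})\to PSU(2)$ sends $[A]_{\mathbb{C}^*}$ with $\det A=1$ to $[A+(A^{\mathbf c})^*]_{\mathbb{R}^*}$ (the class of the unitary factor of the polar decomposition of $A$). Circle bundle. $\mathcal{S}$ is the set of classes $[B]_{\mathbb{R}^*}$ of complex $2\times2$ matrices of rank one, with projection $\pi\colon\mathcal{S}\to Q(\mathbb{C})$, $[B]_{\mathbb{R}^*}\mapsto[B]_{\mathbb{C}^*}$; for $Z\subset Q(\mathbb{C})$, $\mathcal{S}|_Z=\pi^{-1}(Z)$, and a section of $\mathcal{S}$ over $Z$ is a continuous map $\sigma\colon Z\to\mathcal{S}$ with $\pi\circ\sigma=\mathrm{id}_Z$. Cone notation (all sets below are subsets of $\mathbb{C}P^3$). For $I\subset(0,\infty)$ and $T\subset\mathcal{S}$,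 $I\times T:=\{[e^\alpha B+e^{-\alpha}(B^{\mathbf c})^*]_{\mathbb{C}^*}:\alpha\in I,\ [B]_{\mathbb{R}^*}\in T\}$ (for $I=\{r\}$ we write $\{r\}\times T$); for $X\subset PSU(2)$, $\{0\}\times X:=X$; for $Y\subset Q(\mathbb{C})$, $\{\infty\}\times Y:=Y$. Field and valuation. $\mathbb{K}$ is the field of Puiseux series in $t$ (with $t\to\infty$) with complex coefficients, i.e. series $\sum_q a_q t^q$ with $a_q\in\mathbb{C}$ and exponents $q$ in $\frac1N\mathbb{Z}$ for some $N\ge1$ and bounded above; it is algebraically closed. $\mathbb{K}P^3$ is the projectivization of the space of $2\times 2$ matrices over $\mathbb{K}$, and $Q(\mathbb{K})\subset\mathbb{K}P^3$ the quadric $\det=0$. Every nonzero matrix $A$ over $\mathbb{K}$ can be written uniquely as $A=t^\alpha B+(\text{terms with exponents}<\alpha)$ with $\alpha\in\mathbb{Q}$ and $B$ a nonzero complex matrix. The map $\operatorname{VAL}\colon\mathbb{K}P^3\to\mathbb{C}P^3$ is: if $\det A=0$, $\operatorname{VAL}([A])=[B]_{\mathbb{C}^*}\in Q(\mathbb{C})$; if $\det A\ne0$, rescale $A$ so that $\det A=1$ (then $\alpha\ge0$), and set $\operatorname{VAL}([A])=[e^\alpha B+e^{-\alpha}(B^{\mathbf c})^*]_{\mathbb{C}^*}$ (this equals $\varkappa^\circ([B]_{\mathbb{C}^*})$ if $\alpha=0$ and lies in $\{\alpha\}\times\{[B]_{\mathbb{R}^*}\}$ if $\alpha>0$). *)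

(* Defs.v *)
From HB Require Import structures.
From mathcomp Require Import all_boot all_order all_algebra.
From mathcomp Require Import all_classical all_reals all_analysis.
From mathcomp Require Import complex.
Set Implicit Arguments. Unset Strict Implicit. Unset Printing Implicit Defensive.
Import Order.TTheory GRing.Theory Num.Theory.
Local Open Scope classical_set_scope.
Local Open Scope ring_scope.
Local Open Scope complex_scope.

Definition ctr (R : realType) (B : 'M[R[i]]_2) : 'M[R[i]]_2 :=
  (map_mx Num.conj B)^T.

Definition nrm2 (R : realType) (B : 'M[R[i]]_2) : R :=
  \sum_(i < 2) \sum_(j < 2) (complex.Re (B i j) ^+ 2 + complex.Im (B i j) ^+ 2).

Definition cprop (R : realType) (B B' : 'M[R[i]]_2) : Prop :=
  exists l : R[i], l != 0 /\ B' = l *: B.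

Definition rprop (R : realType) (B B' : 'M[R[i]]_2) : Prop :=
  exists l : R, l != 0 /\ B' = l%:C *: B.

(* C^*-saturation of a set of matrices: the subset of CP^3 it represents *)
Definition cls (R : realType) (S : set 'M[R[i]]_2) : set 'M[R[i]]_2 :=
  [set X | exists Y l, S Y /\ l != 0 /\ X = l *: Y].

Definition cone (R : realType) (a : R) (B : 'M[R[i]]_2) : 'M[R[i]]_2 :=
  (expR a)%:C *: B + (expR (- a))%:C *: ctr (\adj B).

Definition cindep (R : realType) (B1 B2 : 'M[R[i]]_2) : Prop :=
  forall s u : R[i], s *: B1 + u *: B2 = 0 -> s = 0 /\ u = 0.

Definition onl (R : realType) (B1 B2 X : 'M[R[i]]_2) : Prop :=
  exists s u : R[i], (s != 0 \/ u != 0) /\ X = s *: B1 + u *: B2.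

(* Spherical coamoeba map: kappa X Y means [Y] = varkappa°([X]);
   X is rescaled to c X with det (c X) = 1, Y = cX + ((cX)^c)^*. *)
Definition kappa (R : realType) (X Y : 'M[R[i]]_2) : Prop :=
  exists c : R[i], c ^+ 2 * \det X = 1 /\ Y = c *: X + ctr (\adj (c *: X)).

(* Distances in CP^3 and in S (quotient metrics on the unit spheres):
   [X], [Y] are delta-close iff they have unit representatives at
   (Frobenius) distance < delta. *)
Definition cclose (R : realType) (d : R) (X Y : 'M[R[i]]_2) : Prop :=
  exists X' Y', cprop X X' /\ cprop Y Y' /\ nrm2 X' = 1 /\ nrm2 Y' = 1 /\
    nrm2 (X' - Y') < d ^+ 2.
Definition rclose (R : realType) (d : R) (X Y : 'M[R[i]]_2) : Prop :=
  exists X' Y', rprop X X' /\ rprop Y Y' /\ nrm2 X' = 1 /\ nrm2 Y' = 1 /\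
    nrm2 (X' - Y') < d ^+ 2.

(* sigma (acting on representatives) is a section of the circle bundle
   S -> Q(C) over the subset Z of Q(C) (Z given by representatives,
   closed under C^*-proportionality). *)
Definition is_section (R : realType) (Z : set 'M[R[i]]_2)
    (sigma : 'M[R[i]]_2 -> 'M[R[i]]_2) : Prop :=
  (forall X, Z X -> cprop X (sigma X)) /\
  (forall X Y, Z X -> Z Y -> cprop X Y -> rprop (sigma X) (sigma Y)) /\
  (forall X, Z X -> forall e : R, 0 < e -> exists d : R, 0 < d /\
     forall Y, Z Y -> cclose d X Y -> rclose e (sigma X) (sigma Y)).

(* tangency of the line spanned by B1, B2 to Q(C) at [P]: P lies on Q and on
   the line, and the line lies in the tangent hyperplane
   T_P Q = {X | d/de det(P + e X)|_{e=0} = tr(P^c X) = 0}. *)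
Definition tangent_at (R : realType) (B1 B2 P : 'M[R[i]]_2) : Prop :=
  onl B1 B2 P /\ \det P = 0 /\
  forall X, onl B1 B2 X -> \tr (\adj P *m X) = 0.

(* A series sum_q a_q t^q is its coefficient function. *)
Definition pser (R : realType) := rat -> R[i].

Definition is_puiseux (R : realType) (a : pser R) : Prop :=
  exists (N : nat) (M : rat), (0 < N)%N /\
    forall q, a q != 0 -> (denq q %| N%:Z)%Z /\ q <= M.

Definition pzero (R : realType) : pser R := fun _ => 0.
Definition pone (R : realType) : pser R := fun q => (q == 0)%:R.
Definition padd (R : realType) (a b : pser R) : pser R := fun q => a q + b q.
Definition psub (R : realType) (a b : pser R) : pser R := fun q => a q - b q.
(* Cauchy product; for Puiseux series the sum is finite *)
Definition pmul (R : realType) (a b : pser R) : pser R :=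
  fun q => \sum_(q1 \in [set: rat]) (a q1 * b (q - q1)).

Definition kmat (R : realType) := 'I_2 -> 'I_2 -> pser R.
Definition is_kmat (R : realType) (A : kmat R) : Prop :=
  forall i j, is_puiseux (A i j).
Definition kdet (R : realType) (A : kmat R) : pser R :=
  psub (pmul (A ord0 ord0) (A ord_max ord_max))
       (pmul (A ord0 ord_max) (A ord_max ord0)).
Definition kscale (R : realType) (c : pser R) (A : kmat R) : kmat R :=
  fun i j => pmul c (A i j).
Definition klin (R : realType) (s : pser R) (A1 : kmat R) (u : pser R)
    (A2 : kmat R) : kmat R :=
  fun i j => padd (pmul s (A1 i j)) (pmul u (A2 i j)).
Definition kzero (R : realType) : kmat R := fun _ _ => pzero R.

Definition kindep (R : realType) (A1 A2 : kmat R) : Prop :=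
  forall s u, is_puiseux s -> is_puiseux u ->
    klin s A1 u A2 = kzero R -> s = pzero R /\ u = pzero R.

Definition konl (R : realType) (A1 A2 X : kmat R) : Prop :=
  exists s u, is_puiseux s /\ is_puiseux u /\
    (s <> pzero R \/ u <> pzero R) /\ X = klin s A1 u A2.

Definition kprop (R : realType) (X Y : kmat R) : Prop :=
  exists c, is_puiseux c /\ c <> pzero R /\ Y = kscale c X.

Definition lead_exp (R : realType) (A : kmat R) (alpha : rat) : Prop :=
  (exists i j, A i j alpha != 0) /\
  (forall i j q, alpha < q -> A i j q = 0).
Definition lead_mat (R : realType) (A : kmat R) (alpha : rat) : 'M[R[i]]_2 :=
  \matrix_(i, j) A i j alpha.

Definition VALrel (R : realType) (A : kmat R) (X : 'M[R[i]]_2) : Prop :=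
  (kdet A = pzero R /\
     exists alpha, lead_exp A alpha /\ X = lead_mat A alpha) \/
  (kdet A <> pzero R /\
     exists c alpha, is_puiseux c /\ kdet (kscale c A) = pone R /\
       lead_exp (kscale c A) alpha /\
       X = cone (ratr alpha) (lead_mat (kscale c A) alpha)).

Definition VALline (R : realType) (A1 A2 : kmat R) : set 'M[R[i]]_2 :=
  [set X | exists A, konl A1 A2 A /\ VALrel A X].

Definition model_i (R : realType) (r : R) (B1 B2 P : 'M[R[i]]_2)
    (sigma : 'M[R[i]]_2 -> 'M[R[i]]_2) : set 'M[R[i]]_2 :=
  [set X | exists Y, onl B1 B2 Y /\ ~ cprop P Y /\ X = cone r (sigma Y)] `|`
  [set X | exists (alpha : rat) (l : R[i]),
             r < ratr alpha /\ l != 0 /\ X = cone (ratr alpha) (l *: P)] `|`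
  [set P].

Definition model_ii (R : realType) (B1 B2 P : 'M[R[i]]_2) : set 'M[R[i]]_2 :=
  [set X | exists Y, onl B1 B2 Y /\ ~ cprop P Y /\ kappa Y X] `|`
  [set X | exists (alpha : rat) (l : R[i]),
             0 < alpha /\ l != 0 /\ X = cone (ratr alpha) (l *: P)] `|`
  [set P].

(* Main.v *)
(* The Puiseux series form a field in which every nonzero element D has an
   inverse square root.  Let P be the point of L on the quadric and N another
   point of L: since s = 0 is the only zero of det (s N + u P), the determinant
   is s^2 det N on L, and N can be rescaled to have determinant 1.  Subtracting
   a multiple of P, one may moreover assume that an entry of N vanishes at which
   the leading matrix P0 of P does not, so that the leading matrix N0 of N is not
   proportional to P0.  Let alpha be the leading exponent of N; it is nonnegative
   because det N = 1.  The leading term of N + u P is t^alpha (N0 + c P0) as long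
   as u P has no term above t^alpha, and otherwise it is that of u P, an arbitrary
   c t^beta P0 with beta > alpha.  The leading coefficients of det N = 1, det P = 0
   and of their polarization say that the line through N0 and P0 lies on the
   quadric if alpha > 0, and that it is tangent at P0 if alpha = 0.  In the first
   case the section divides a matrix by its N0-coordinate. *)
Require Import Defs.
From HB Require Import structures.
From mathcomp Require Import all_boot all_order all_algebra.
From mathcomp Require Import all_classical all_reals all_analysis.
From mathcomp Require Import complex.
From mathcomp Require Import ring lra.
Import Order.TTheory GRing.Theory Num.Theory.
Local Open Scope classical_set_scope.
Local Open Scope ring_scope.
Local Open Scope complex_scope.

Set Implicit Arguments.
Unset Strict Implicit.
Unset Printing Implicit Defensive.

(** * The field of Puiseux series *)

Lemma denq_dvd (q : rat) (k : int) :
  q * k%:~R \is a Num.int -> (denq q %| k)%Z.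
Proof.
move=> /intrP[m hm].
have h : numq q * k = m * denq q.
  apply: (@intr_inj rat); rewrite !rmorphM /= -hm.
  by rewrite numqE; ring.
rewrite -(@Gauss_dvdzr _ (numq q)) ?h ?dvdz_mull //.
by rewrite coprimez_sym /coprimez /gcdz; apply: coprime_num_den.
Qed.

Lemma denq_dvd_int (q : rat) (k : int) :
  (denq q %| k)%Z -> q * k%:~R \is a Num.int.
Proof.
move=> /dvdzP[m ->].
by rewrite rmorphM /= mulrCA -numqE rpredM ?intr_int.
Qed.

(* The series with coefficient [f n] at the exponent [M - n/N]. *)
Definition ser (R : realType) (N : nat) (M : rat) (f : nat -> R[i]) : pser R :=
  fun q => let x := N%:R * (M - q) in
    if x \is a Num.nat then f (Num.truncn x) else 0.

Lemma ser_at (R : realType) N M (f : nat -> R[i]) n : (0 < N)%N ->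
  ser N M f (M - n%:R / N%:R) = f n.
Proof.
move=> N0; rewrite /ser.
have -> : N%:R * (M - (M - n%:R / N%:R)) = n%:R :> rat.
  by field; rewrite pnatr_eq0 -lt0n.
by rewrite natr_nat natrK.
Qed.

(** Allows coefficientwise proofs to treat only grid exponents. The second alternative is uniform in
    [f], so it is refuted by the series whose coefficients are all 1. *)
Lemma serP (R : realType) N M q : (0 < N)%N ->
  (exists n, q = M - n%:R / N%:R) \/
  (forall f : nat -> R[i], ser N M f q = 0).
Proof.
move=> N0; have N0' : N%:R != 0 :> rat by rewrite pnatr_eq0 -lt0n.
case: (boolP (N%:R * (M - q) \is a Num.nat)) => [/natrP[n hn]|h]; last first.
  by right=> f; rewrite /ser (negbTE h).
by left; exists n; rewrite -hn; field.
Qed.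

Lemma is_puiseux_ser (R : realType) N M (f : nat -> R[i]) : (0 < N)%N ->
  is_puiseux (ser N M f).
Proof.
(* The top exponent [M] is an arbitrary rational, so its denominator enters the common one. *)
move=> N0; exists (N * `|denq M|)%N, M; split.
  by rewrite muln_gt0 N0 absz_gt0 denq_eq0.
move=> q; case: (@serP R N M q N0) => [[n ->]|->]; last by rewrite eqxx.
move=> _; split; last by rewrite lerBlDr lerDl divr_ge0.
apply: denq_dvd; rewrite PoszM abszE gtr0_norm ?denq_gt0 //.
have N0' : N%:R != 0 :> rat by rewrite pnatr_eq0 -lt0n.
have -> : (M - n%:R / N%:R) * (N%:Z * denq M)%:~R =
   (M * (denq M)%:~R) * N%:R - n%:R * (denq M)%:~R :> rat.
  by rewrite rmorphM /= -pmulrn; field.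
by apply: rpredB; apply: rpredM; rewrite ?rpred_nat ?intr_int // denq_dvd_int.
Qed.

(** An integer bound lies in [1/N Z] for every [N], hence so do all the gaps [m - q]. *)
Lemma ser_expand (R : realType) N (m : int) (a : pser R) : (0 < N)%N ->
  (forall q, a q != 0 -> (denq q %| N%:Z)%Z /\ q <= m%:~R) ->
  a = ser N m%:~R (fun n => a (m%:~R - n%:R / N%:R)).
Proof.
move=> N0 h; apply/funext => q.
have N0' : N%:R != 0 :> rat by rewrite pnatr_eq0 -lt0n.
case: (boolP (N%:R * (m%:~R - q) \is a Num.nat)) => [/natrP[n hn]|hq].
  have -> : q = m%:~R - n%:R / N%:R by rewrite -hn; field.
  by rewrite ser_at.
rewrite /ser (negbTE hq); apply/eqP; apply: contraNT hq => /h[h1 h2].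
have h3 : 0 <= N%:R * (m%:~R - q) :> rat by rewrite mulr_ge0 ?subr_ge0.
rewrite natrEint h3 andbT mulrBr; apply: rpredB.
  by rewrite rpredM ?rpred_nat ?intr_int.
by rewrite mulrC (denq_dvd_int h1).
Qed.

(** Multiplying the denominators and taking the largest bound puts finitely many series on one grid,
    where identities between them become identities between coefficient sequences. *)
Lemma ser_repr_seq (R : realType) (s : seq (pser R)) :
  (forall a, a \in s -> is_puiseux a) ->
  exists N (m : int), (0 < N)%N /\
    forall a, a \in s -> exists f, a = ser N m%:~R f.
Proof.
move=> hs.
suff [N [m [N0 h]]] : exists N (m : int), (0 < N)%N /\ forall a, a \in s ->
    forall q, a q != 0 -> (denq q %| N%:Z)%Z /\ q <= m%:~R.
  exists N, m; split=> // a /h ha; eexists; exact: (ser_expand N0 ha).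
elim: s hs => [|a s IH] hs; first by exists 1%N, 0.
have [|N [m [N0 h]]] := IH; first by move=> b hb; apply: hs; rewrite inE hb orbT.
have [N' [M [N'0 h']]] := hs a (mem_head _ _).
exists (N * N')%N, (Num.max m (Num.ceil M)); split; first by rewrite muln_gt0 N0.
move=> b; rewrite inE => /orP[/eqP ->|/h hb] q.
  move=> /h'[h1 h2]; split; first by rewrite PoszM dvdz_mull.
  by apply: (le_trans h2); apply: (le_trans (ceil_ge _));
    rewrite ler_int le_max lexx orbT.
move=> /hb[h1 h2]; split; first by rewrite PoszM dvdz_mulr.
by apply: (le_trans h2); rewrite ler_int le_max lexx.
Qed.

Definition cauchyp (C : pzRingType) (f g : nat -> C) n :=
  \sum_(i < n.+1) f i * g (n - i)%N.

Lemma pmul_ser (R : realType) N M M' (f g : nat -> R[i]) : (0 < N)%N ->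
  pmul (ser N M f) (ser N M' g) = ser N (M + M') (cauchyp f g).
Proof.
move=> N0; apply/funext => q; rewrite /pmul.
have N0' : N%:R != 0 :> rat by rewrite pnatr_eq0 -lt0n.
case: (@serP R N (M + M') q N0) => [[n ->]|hq]; last first.
  rewrite hq; apply: fsbig1 => q1 _.
  case: (@serP R N M q1 N0) => [[k hk]|->]; last by rewrite mul0r.
  case: (@serP R N M' (q - q1) N0) => [[l hl]|->];
    last by rewrite mulr0.
  (* If both factors sat at grid exponents, [q] would lie on the grid of the product, where the
     all-ones series does not vanish. *)
  have hf : ser N (M + M') (fun=> 1 : R[i]) (M + M' - (k + l)%:R / N%:R) = 1.
    by rewrite ser_at.
  have hqq : q = M + M' - (k + l)%:R / N%:R.
    by rewrite natrD -[q](subrK q1) hl hk; field.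
  by move: hf; rewrite -hqq hq => /eqP; rewrite eq_sym oner_eq0.
(* Only [q1 = M - k/N] with [k <= n] can contribute: a larger [k] puts the second factor above its
   top exponent. *)
rewrite ser_at // (fsbigE [seq M - k%:R / N%:R | k <- iota 0 n.+1]) //.
- rewrite big_map -[iota 0 n.+1]/(index_iota 0 n.+1) big_mkord /cauchyp.
  under eq_bigl do rewrite in_setT.
  apply: eq_bigr => i _; rewrite ser_at //.
  have -> : M + M' - n%:R / N%:R - (M - i%:R / N%:R) = M' - (n - i)%:R / N%:R.
    by rewrite natrB ?leq_ord //; field.
  by rewrite ser_at.
- rewrite map_inj_uniq ?iota_uniq // => i j /= /addrI /oppr_inj /divIf.
  by move=> h; apply/eqP; rewrite -(@eqr_nat rat) h.
- move=> q1 _ hq1.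
  case: (@serP R N M q1 N0) => [[k hk]|->]; last by rewrite mul0r.
  case: (@serP R N M' (M + M' - n%:R / N%:R - q1) N0) => [[l hl]|->];
    last by rewrite mulr0.
  case/negP: hq1; apply/mapP; exists k => //; rewrite mem_iota /= ltnS.
  have e : n%:R = (k + l)%:R :> rat.
    rewrite natrD; apply: (divIf N0').
    by rewrite mulrDl; move: hl; rewrite hk; lra.
  by move/eqP: e; rewrite eqr_nat => /eqP ->; rewrite leq_addr.
Qed.

(** The [n]-th coefficient involves only indices up to [n], so truncation loses nothing and the laws
    of convolution follow from those of polynomials. *)
Lemma cauchyp_poly (C : nzRingType) (f g : nat -> C) m n : (n < m)%N ->
  cauchyp f g n = ((\poly_(i < m) f i) * (\poly_(i < m) g i))`_n.
Proof.
move=> hn; rewrite coefM; apply: eq_bigr => i _.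
by rewrite !coef_poly (leq_ltn_trans (leq_ord i) hn)
  (leq_ltn_trans (leq_subr _ _) hn).
Qed.

Lemma cauchypC (C : comNzRingType) (f g : nat -> C) : cauchyp f g = cauchyp g f.
Proof.
by apply/funext => n; rewrite !(@cauchyp_poly _ _ _ n.+1) // mulrC.
Qed.

Lemma cauchyp3_poly (C : nzRingType) (f g h : nat -> C) m n : (n < m)%N ->
  cauchyp (cauchyp f g) h n =
  ((\poly_(i < m) f i) * (\poly_(i < m) g i) * (\poly_(i < m) h i))`_n.
Proof.
move=> hn; rewrite coefM; apply: eq_bigr => i _.
rewrite (@cauchyp_poly _ _ _ m) ?(leq_ltn_trans (leq_ord i) hn) //.
by rewrite !coef_poly (leq_ltn_trans (leq_subr _ _) hn).
Qed.

Lemma cauchypA (C : comNzRingType) (f g h : nat -> C) :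
  cauchyp (cauchyp f g) h = cauchyp f (cauchyp g h).
Proof.
apply/funext => n; rewrite (cauchypC f (cauchyp g h)).
by rewrite !(@cauchyp3_poly _ _ _ _ n.+1) // -mulrA mulrC.
Qed.

Lemma pone_ser (R : realType) N : (0 < N)%N ->
  pone R = ser N 0 (fun n => (n == 0%N)%:R).
Proof.
move=> N0; apply/funext => q; rewrite /pone.
case: (@serP R N 0 q N0) => [[n ->]|hq]; last first.
  rewrite hq; case: eqP => // q0.
  have := ser_at 0 (fun=> 1 : R[i]) 0 N0.
  by rewrite mul0r subr0 -[X in ser _ _ _ X]q0 hq => /eqP; rewrite eq_sym oner_eq0.
by rewrite ser_at // sub0r oppr_eq0 mulf_eq0 invr_eq0 !pnatr_eq0
  -(negbK (N == 0%N)) -lt0n N0 orbF.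
Qed.

Lemma ser_repr2 (R : realType) (a b : pser R) : is_puiseux a -> is_puiseux b ->
  exists N (m : int) f g,
    (0 < N)%N /\ a = ser N m%:~R f /\ b = ser N m%:~R g.
Proof.
move=> ha hb; have [|N [m [N0 h]]] := @ser_repr_seq R [:: a; b].
  by move=> c; rewrite !inE => /orP[] /eqP ->.
have [f ef] := h a (mem_head _ _); have [|g eg] := h b; first by rewrite !inE eqxx orbT.
by exists N, m, f, g.
Qed.

Lemma pmul_puiseux (R : realType) (a b : pser R) :
  is_puiseux a -> is_puiseux b -> is_puiseux (pmul a b).
Proof.
move=> ha hb; have [N [m [f [g [N0 [-> ->]]]]]] := ser_repr2 ha hb.
by rewrite pmul_ser //; apply: is_puiseux_ser.
Qed.

Lemma pone_puiseux (R : realType) : is_puiseux (pone R).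
Proof. by rewrite (@pone_ser R 1) //; apply: is_puiseux_ser. Qed.

Lemma serD (R : realType) N M (f g : nat -> R[i]) :
  padd (ser N M f) (ser N M g) = ser N M (fun n => f n + g n).
Proof. by apply/funext => q; rewrite /padd /ser; case: ifP; rewrite ?addr0. Qed.

Lemma psub_puiseux (R : realType) (a b : pser R) :
  is_puiseux a -> is_puiseux b -> is_puiseux (psub a b).
Proof.
move=> ha hb; have [N [m [f [g [N0 [-> ->]]]]]] := ser_repr2 ha hb.
suff -> : psub (ser N m%:~R f) (ser N m%:~R g) = ser N m%:~R (fun n => f n - g n).
  exact: is_puiseux_ser.
by apply/funext => q; rewrite /psub /ser; case: ifP; rewrite ?subr0.
Qed.

Lemma pmulC (R : realType) (a b : pser R) :
  is_puiseux a -> is_puiseux b -> pmul a b = pmul b a.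
Proof.
move=> ha hb; have [N [m [f [g [N0 [-> ->]]]]]] := ser_repr2 ha hb.
by rewrite !pmul_ser // cauchypC.
Qed.

Lemma pmul1 (R : realType) (a : pser R) : is_puiseux a -> pmul (pone R) a = a.
Proof.
move=> ha; have [|N [m [N0 h]]] := @ser_repr_seq R [:: a].
  by move=> c; rewrite inE => /eqP ->.
have [f ->] := h a (mem_head _ _).
rewrite (pone_ser _ N0) pmul_ser // add0r; congr ser; apply/funext => n.
rewrite /cauchyp big_ord_recl /= mul1r subn0 big1 ?addr0 // => i _.
by rewrite mul0r.
Qed.

Lemma pmulA_pmulDl (R : realType) (a b c : pser R) :
  is_puiseux a -> is_puiseux b -> is_puiseux c ->
  pmul a (pmul b c) = pmul (pmul a b) c /\
  pmul (padd a b) c = padd (pmul a c) (pmul b c).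
Proof.
move=> ha hb hc; have [|N [m [N0 h]]] := @ser_repr_seq R [:: a; b; c].
  by move=> d; rewrite !inE => /or3P[] /eqP ->.
have [f ->] := h a (mem_head _ _).
have [|g ->] := h b; first by rewrite !inE eqxx orbT.
have [|k ->] := h c; first by rewrite !inE eqxx !orbT.
rewrite serD !pmul_ser // serD addrA cauchypA; split => //; congr ser.
apply/funext => n; rewrite /cauchyp -big_split /=; apply: eq_bigr => i _.
by rewrite mulrDl.
Qed.

Definition puiseux_pred (R : realType) : {pred rat -> R[i]} :=
  [pred a | `[< is_puiseux (a : pser R) >]].

Lemma puiseux_zmod_closed (R : realType) : zmod_closed (@puiseux_pred R).
Proof.
split=> [|a b]; rewrite !inE.
  by exists 1%N, 0; split => // q; rewrite eqxx.
exact: psub_puiseux.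
Qed.

HB.instance Definition _ (R : realType) :=
  GRing.isZmodClosed.Build (rat -> R[i]) (@puiseux_pred R) (@puiseux_zmod_closed R).

(** As a subtype of the coefficient functions it inherits their addition, and elements coerce back
    to the series of the statement. *)
Record puiseux (R : realType) := Puiseux {
  coefs :> rat -> R[i]; coefsP : coefs \in @puiseux_pred R }.

HB.instance Definition _ (R : realType) := [isSub for @coefs R].
HB.instance Definition _ (R : realType) := [Choice of puiseux R by <:].
HB.instance Definition _ (R : realType) :=
  [SubChoice_isSubZmodule of puiseux R by <:].

Lemma is_puiseuxP (R : realType) (a : puiseux R) : is_puiseux (a : pser R).
Proof. by have := coefsP a; rewrite inE. Qed.

Definition mkpuiseux (R : realType) (a : pser R) (h : is_puiseux a) : puiseux R :=
  @Puiseux R a (introT (asboolP _) h).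

Definition puiseux_one (R : realType) := mkpuiseux (@pone_puiseux R).
Definition puiseux_mul (R : realType) (a b : puiseux R) :=
  mkpuiseux (pmul_puiseux (is_puiseuxP a) (is_puiseuxP b)).

Lemma puiseux_mulA (R : realType) : associative (@puiseux_mul R).
Proof.
move=> a b c; apply: val_inj.
by have [] := pmulA_pmulDl (is_puiseuxP a) (is_puiseuxP b) (is_puiseuxP c).
Qed.
Lemma puiseux_mulC (R : realType) : commutative (@puiseux_mul R).
Proof. by move=> a b; apply: val_inj; apply: pmulC; apply: is_puiseuxP. Qed.
Lemma puiseux_mul1 (R : realType) : left_id (puiseux_one R) (@puiseux_mul R).
Proof. by move=> a; apply: val_inj; apply: pmul1; apply: is_puiseuxP. Qed.
Lemma puiseux_mulDl (R : realType) : left_distributive (@puiseux_mul R) +%R.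
Proof.
move=> a b c; apply: val_inj.
by have [] := pmulA_pmulDl (is_puiseuxP a) (is_puiseuxP b) (is_puiseuxP c).
Qed.
Lemma puiseux_one_neq0 (R : realType) : puiseux_one R != 0.
Proof.
apply/eqP => /(congr1 (fun a : puiseux R => a 0)) /eqP.
by rewrite /= /pone eqxx oner_eq0.
Qed.

HB.instance Definition _ (R : realType) :=
  GRing.Zmodule_isComNzRing.Build (puiseux R) (@puiseux_mulA R)
    (@puiseux_mulC R) (@puiseux_mul1 R) (@puiseux_mulDl R) (@puiseux_one_neq0 R).

(** * Inverse square roots and the field structure *)

Section InverseSquareRoot.
Variables (C : fieldType) (f : nat -> C) (g0 : C).

(* Truncations of the power series [f ^ (-1/2)]; [g0] is the chosen value of
   [f 0 ^ (-1/2)]. *)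
Fixpoint invsqrt_poly n : {poly C} :=
  if n is n'.+1 then
    invsqrt_poly n' - ((invsqrt_poly n' ^+ 2 * \poly_(i < n.+1) f i)`_n
      / (2 * g0 * f 0)) *: 'X^n
  else g0%:P.

Definition invsqrt_coef n := (invsqrt_poly n)`_n.

Lemma size_invsqrt_poly n : (size (invsqrt_poly n) <= n.+1)%N.
Proof.
elim: n => [|n IH] /=; first exact: size_polyC_leq1.
rewrite (leq_trans (size_polyD _ _)) // geq_max (leq_trans IH) //=.
by rewrite size_polyN (leq_trans (size_scale_leq _ _)) // size_polyXn.
Qed.

Lemma coef_invsqrt_poly n i : (i <= n)%N ->
  (invsqrt_poly n)`_i = invsqrt_coef i.
Proof.
elim: n => [|n IH]; first by rewrite leqn0 => /eqP ->.
rewrite leq_eqVlt => /orP[/eqP -> //|hi] /=.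
by rewrite coefB coefZ coefXn (ltn_eqF hi) mulr0 subr0 IH.
Qed.

Lemma poly_invsqrt_coef n : \poly_(i < n.+1) invsqrt_coef i = invsqrt_poly n.
Proof.
apply/polyP => i; rewrite coef_poly ltnS; case: leqP => hi.
  by rewrite coef_invsqrt_poly.
by rewrite nth_default // (leq_trans (size_invsqrt_poly n)).
Qed.

(** Degree 0 is the choice of [g0]. In each later degree the new term of the truncation changes the
    coefficient by [- 2 c g0 f(0)], and [c] was chosen to cancel what was there. *)
Lemma cauchyp_invsqrt : 2 != 0 :> C -> g0 ^+ 2 * f 0 = 1 ->
  cauchyp (cauchyp invsqrt_coef invsqrt_coef) f = fun n => (n == 0%N)%:R.
Proof.
move=> two hg; apply/funext => n.
have f0 : f 0 != 0 by apply/eqP => e; move/eqP: hg; rewrite e mulr0 eq_sym oner_eq0.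
have g00 : g0 != 0.
  by apply/eqP => e; move/eqP: hg; rewrite e expr0n mul0r eq_sym oner_eq0.
rewrite (@cauchyp3_poly _ _ _ _ n.+1) // poly_invsqrt_coef -expr2.
case: n => [|n] /=.
  by rewrite -rmorphXn /= mul_polyC coefZ coef_poly hg.
set G := invsqrt_poly n; set F := \poly_(i < n.+2) f i.
set c := _ / _.
(* The term quadratic in [c] is divisible by the square of ['X^(n.+1)], so it does not reach degree
   [n.+1]. *)
have -> : (G - c *: 'X^(n.+1)) ^+ 2 * F =
  G ^+ 2 * F - (c + c) *: ('X^(n.+1) * (G * F)) +
    c ^+ 2 *: ('X^(n.+1) * ('X^(n.+1) * F)).
  by rewrite -!mul_polyC rmorphXn rmorphD /=; ring.
rewrite !(coefD, coefN, coefZ, coefXnM) ltnn subnn ltnS leq0n mulr0 addr0.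
rewrite coef0M coef_poly /= coef_invsqrt_poly // /invsqrt_coef /= coefC eqxx /c.
by field; rewrite f0 g00 two.
Qed.

End InverseSquareRoot.

Definition mon (R : realType) (l : R[i]) (q : rat) : pser R :=
  fun q' => if q' == q then l else 0.

Lemma mon_ser (R : realType) (l : R[i]) q :
  mon l q = ser 1 q (fun n => if n is 0%N then l else 0).
Proof.
apply/funext => q'; rewrite /mon.
case: (@serP R 1 q q' isT) => [[n ->]|hq]; last first.
  rewrite hq; case: eqP => // e.
  have := ser_at q (fun=> 1 : R[i]) 0 (isT : 0 < 1)%N.
  by rewrite mul0r subr0 -[X in ser _ _ _ X]e hq => /eqP; rewrite eq_sym oner_eq0.
rewrite ser_at // divr1 -subr_eq0 addrAC subrr sub0r oppr_eq0 pnatr_eq0.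
by case: n.
Qed.

(** Shifting the grid by the least index with a nonzero coefficient makes the series start at its
    leading term. *)
Lemma ser_lead (R : realType) (a : pser R) : is_puiseux a -> a <> pzero R ->
  exists N M f, (0 < N)%N /\ a = ser N M f /\ f 0%N != 0.
Proof.
move=> ha a0; have [|N [m [N0 h]]] := @ser_repr_seq R [:: a].
  by move=> c; rewrite inE => /eqP ->.
have [f ef] := h a (mem_head _ _).
have N0' : N%:R != 0 :> rat by rewrite pnatr_eq0 -lt0n.
have hex : exists n, f n != 0.
  apply/not_existsP => hf; apply: a0; rewrite ef; apply/funext => q.
  rewrite /ser; case: ifP => // _; set n := Num.truncn _.
  by have /negP := hf n; rewrite negbK => /eqP.
case: (ex_minnP hex) => n0 fn0 hmin.
exists N, (m%:~R - n0%:R / N%:R), (fun n => f (n + n0)%N); split => //; split => //.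
have step n : m%:~R - n0%:R / N%:R - n%:R / N%:R = m%:~R - (n + n0)%:R / N%:R :> rat.
  by rewrite natrD; field.
rewrite ef; apply/funext => q.
case: (@serP R N (m%:~R - n0%:R / N%:R) q N0) => [[n ->]|hq].
  by rewrite [RHS]ser_at // step ser_at.
rewrite hq; case: (@serP R N m%:~R q N0) => [[k ek]|-> //].
rewrite ek ser_at //; case: (ltnP k n0) => hk.
  by apply/eqP; apply: contraTT hk => /hmin; rewrite -leqNgt.
(* An index [k >= n0] lies on the shifted grid as well, against [hq]. *)
have := ser_at (m%:~R - n0%:R / N%:R) (fun=> 1 : R[i]) (k - n0) N0.
by rewrite step subnK // -ek hq => /eqP; rewrite eq_sym oner_eq0.
Qed.

(** [D] is [t^M] times a power series in [t^(-1/N)] with nonzero constant term; the inverse square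
    root is [t^(-M/2)] times that of the power series. *)
Lemma puiseux_invsqrt (R : realType) (D : puiseux R) : D != 0 ->
  exists c : puiseux R, c ^+ 2 * D = 1.
Proof.
move=> D0; have [|N [M [f [N0 [eD f0]]]]] := ser_lead (is_puiseuxP D).
  by move=> e; case/eqP: D0; apply: val_inj.
pose g := invsqrt_coef f (sqrtc (f 0%N))^-1.
exists (mkpuiseux (is_puiseux_ser (- M / 2) g N0)); rewrite expr2; apply: val_inj.
change (pmul (pmul (ser N (- M / 2) g) (ser N (- M / 2) g)) D = pone R).
rewrite eD !pmul_ser // cauchyp_invsqrt ?pnatr_eq0 //; last first.
  by rewrite exprVn sqr_sqrtc mulVf.
by rewrite (pone_ser _ N0); congr ser; field.
Qed.

(** The inverse is obtained by choice; for nonzero [a] it exists as the square of an inverse square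
    root. *)
Definition puiseux_inv (R : realType) (a : puiseux R) : puiseux R :=
  if pselect (exists b, b * a = 1) is left h then sval (cid h) else 0.

Lemma puiseux_mulVf (R : realType) (a : puiseux R) : a != 0 ->
  puiseux_inv a * a = 1.
Proof.
move=> /puiseux_invsqrt[c hc]; rewrite /puiseux_inv; case: pselect => [h|[]].
  exact: svalP (cid h).
by exists (c ^+ 2).
Qed.

Lemma puiseux_inv0 (R : realType) : puiseux_inv 0 = 0 :> puiseux R.
Proof.
rewrite /puiseux_inv; case: pselect => // h; exfalso; case: h => b.
by rewrite mulr0 => /eqP; rewrite eq_sym oner_eq0.
Qed.

HB.instance Definition _ (R : realType) :=
  GRing.ComNzRing_isField.Build (puiseux R) (@puiseux_mulVf R) (@puiseux_inv0 R).

(** * Leading terms of series *)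

(** On a common grid the exponents are [m - n/N], so the largest one that occurs corresponds to the
    least [n]. *)
Lemma puiseux_lead (R : realType) (s : seq (puiseux R)) :
  (exists2 a, a \in s & a != 0) ->
  exists q, (exists2 a : puiseux R, a \in s & a q != 0) /\
    forall (a : puiseux R) q', a \in s -> q < q' -> a q' = 0.
Proof.
move=> [a as0 a0].
have [|N [m [N0 h]]] := @ser_repr_seq R (map (fun a : puiseux R => a : pser R) s).
  by move=> c /mapP[x _ ->]; apply: is_puiseuxP.
pose P n := `[< exists2 a : puiseux R, a \in s & a (m%:~R - n%:R / N%:R) != 0 >].
have hP (b : puiseux R) q : b \in s -> b q != 0 ->
    exists2 n, P n & q = m%:~R - n%:R / N%:R.
  move=> bs bq; have [f ef] := h b (map_f _ bs).
  case: (@serP R N m%:~R q N0) => [[n e]|hq]; last first.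
    by move: bq; rewrite -[b q]/((b : pser R) q) ef hq eqxx.
  by exists n => //; apply/asboolP; exists b => //; rewrite -e.
have hex : exists n, P n.
  have [q /eqP bq] : exists q, a q <> 0.
    apply/not_existsP => ha; case/eqP: a0; apply: val_inj; apply/funext => q.
    exact: contrapT (ha q).
  by have [n ? _] := hP a q as0 bq; exists n.
case: (ex_minnP hex) => n /asboolP[b bs bn] hmin.
exists (m%:~R - n%:R / N%:R); split; first by exists b.
move=> d q' ds hq; apply/eqP; apply: contraTT hq => /(hP _ _ ds)[k /hmin nk ->].
by rewrite -leNgt lerB // ler_pM2r ?invr_gt0 ?ltr0n // ler_nat.
Qed.

Lemma puiseux_lead1 (R : realType) (u : puiseux R) : u != 0 ->
  exists q, u q != 0 /\ forall q', q < q' -> u q' = 0.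
Proof.
move=> u0; have [|q [[a ua aq] h]] := @puiseux_lead R [:: u].
  by exists u; rewrite ?mem_head.
move: ua; rewrite mem_seq1 => /eqP ea; exists q; split; first by rewrite -ea.
by move=> q'; apply: h; rewrite mem_head.
Qed.

(** Here [al] and [be] are only upper bounds for the exponents: in the coefficient at [al + be] any
    other pair has one exponent above its bound. *)
Lemma pmul_lead (R : realType) (a b : pser R) al be :
  (forall q, al < q -> a q = 0) -> (forall q, be < q -> b q = 0) ->
  pmul a b (al + be) = a al * b be /\
  (forall q, al + be < q -> pmul a b q = 0).
Proof.
move=> ha hb; split=> [|q hq].
  rewrite /pmul (fsbigE [:: al]) //; first by
    rewrite big_mkcond big_seq1 in_setT addrC addKr.
  move=> q _; rewrite inE => hq; case: (ltgtP q al) hq => // h _.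
    by rewrite [b _]hb ?mulr0 // ltrBrDl ltrD2r.
  by rewrite ha ?mul0r.
rewrite /pmul; apply: fsbig1 => q1 _; case: (ltP al q1) => h.
  by rewrite ha ?mul0r.
by rewrite [b _]hb ?mulr0 // ltrBrDl (le_lt_trans _ hq) // lerD2r.
Qed.

Lemma mon_puiseux (R : realType) (l : R[i]) q : is_puiseux (mon l q).
Proof. by rewrite mon_ser; apply: is_puiseux_ser. Qed.

Definition monK (R : realType) (l : R[i]) (q : rat) : puiseux R :=
  mkpuiseux (mon_puiseux l q).

Lemma monKE (R : realType) (l : R[i]) q q' : monK l q q' = if q' == q then l else 0.
Proof. by []. Qed.

(** * Lines meeting the quadric in one point *)

Lemma cofactor2 (F : comNzRingType) (A : 'M[F]_2) i j :
  cofactor A i j = (-1) ^+ (i + j) * A (lift i ord0) (lift j ord0).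
Proof. by rewrite /cofactor det_mx11 !mxE. Qed.

Lemma lift0_2 : lift ord0 ord0 = ord_max :> 'I_2.
Proof. exact: val_inj. Qed.

Lemma lift1_2 : lift ord_max ord0 = ord0 :> 'I_2.
Proof. exact: val_inj. Qed.

Lemma sum_ord2 (V : nmodType) (f : 'I_2 -> V) :
  \sum_(i < 2) f i = f ord0 + f ord_max.
Proof. by rewrite big_ord_recl big_ord1 lift0_2. Qed.

Lemma det2E (F : comNzRingType) (A : 'M[F]_2) :
  \det A = A ord0 ord0 * A ord_max ord_max - A ord0 ord_max * A ord_max ord0.
Proof.
by rewrite (expand_det_row _ ord0) sum_ord2 !cofactor2 !lift0_2 !lift1_2 /=; ring.
Qed.

(** The symmetric bilinear form of the quadric, with [det_polar A A] equal to twice the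
    determinant. *)
Definition det_polar (F : comNzRingType) (A B : 'M[F]_2) : F :=
  A ord0 ord0 * B ord_max ord_max + A ord_max ord_max * B ord0 ord0
  - A ord0 ord_max * B ord_max ord0 - A ord_max ord0 * B ord0 ord_max.

Lemma det_comb (F : comNzRingType) (A B : 'M[F]_2) s u :
  \det (s *: A + u *: B) = s ^+ 2 * \det A + s * u * det_polar A B + u ^+ 2 * \det B.
Proof. by rewrite !det2E /det_polar !mxE; ring. Qed.

Lemma mxtrace_adj_polar (F : comNzRingType) (A B : 'M[F]_2) :
  \tr (\adj A *m B) = det_polar B A.
Proof.
rewrite /mxtrace sum_ord2 !mxE !sum_ord2 !mxE !cofactor2 !lift0_2 !lift1_2 /det_polar /=.
by ring.
Qed.

Section FieldLines.
Variable F : fieldType.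
Implicit Types A B N P X : 'M[F]_2.

Definition lindep2 A B := forall s u : F, s *: A + u *: B = 0 -> s = 0 /\ u = 0.
Definition inspan A B X := exists s u : F, X = s *: A + u *: B.

Lemma inspan_comb A B X Y s u : inspan A B X -> inspan A B Y ->
  inspan A B (s *: X + u *: Y).
Proof.
move=> [a [b ->]] [c [d ->]]; exists (s * a + u * c), (s * b + u * d).
by rewrite !scalerDr !scalerA !scalerDl addrACA.
Qed.

Lemma inspanl A B : inspan A B A.
Proof. by exists 1, 0; rewrite scale1r scale0r addr0. Qed.

Lemma inspanr A B : inspan A B B.
Proof. by exists 0, 1; rewrite scale1r scale0r add0r. Qed.

Lemma exists_complement A B P : lindep2 A B -> inspan A B P -> P != 0 ->
  exists N, lindep2 N P /\ forall X, inspan A B X <-> inspan N P X.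
Proof.
(* Since [P] is nonzero, one of its coordinates is; after a swap it is that of [A], and then [B]
   complements [P]. *)
wlog : A B / exists s u, s != 0 /\ P = s *: A + u *: B.
  move=> wl ind [s [u eP]] P0; have [s0|s0] := eqVneq s 0; last first.
    by apply: (wl A B) => //; exists s, u.
  have [|||N [i h]] := wl B A _ _ _ P0.
  - exists u, 0; rewrite eP s0 !scale0r add0r addr0; split=> //.
    by apply: contraNneq P0 => u0; rewrite eP s0 u0 !scale0r addr0.
  - by move=> a b; rewrite addrC => /ind[-> ->].
  - by exists u, s; rewrite addrC.
  exists N; split=> // X; rewrite -h.
  by split=> -[a [b ->]]; exists b, a; rewrite addrC.
move=> [s [u [s0 eP]]] ind _ _; exists B; split.
  move=> a b; rewrite eP scalerDr !scalerA addrCA -scalerDl => /ind[/eqP].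
  rewrite mulf_eq0 (negbTE s0) orbF => /eqP ->.
  by rewrite mul0r addr0.
have eA : A = - (u / s) *: B + s^-1 *: P.
  rewrite eP scalerDr !scalerA mulVf // scale1r addrCA -scalerDl.
  by rewrite [u / s]mulrC addNr scale0r addr0.
move=> X; split=> [[a [b ->]]|[a [b ->]]]; apply: inspan_comb.
- by rewrite eA; apply: inspan_comb; [exact: inspanl | exact: inspanr].
- exact: inspanl.
- exact: inspanr.
- by exists s, u.
Qed.

Lemma tangent_normal_form A B P (i j : 'I_2) :
  (forall D : F, D != 0 -> exists c, c ^+ 2 * D = 1) ->
  lindep2 A B -> inspan A B P -> P i j != 0 -> \det P = 0 ->
  (forall X, inspan A B X -> X != 0 -> \det X = 0 -> exists c, X = c *: P) ->
  exists N, N i j = 0 /\ \det N = 1 /\ det_polar N P = 0 /\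
    forall X, inspan A B X <-> inspan N P X.
Proof.
move=> sqrtF ind hP Pij dP uniqP.
have P0 : P != 0 by apply: contraNneq Pij => ->; rewrite mxE.
have [N [indN spN]] := exists_complement ind hP P0.
have nz s u : s != 0 -> s *: N + u *: P != 0.
  by move=> s0; apply: contraNneq s0 => /indN[->].
have notP s u c : s != 0 -> s *: N + u *: P <> c *: P.
  move=> s0 h; case/eqP: s0; apply: (proj1 (indN s (u - c) _)).
  by rewrite scalerBl addrA h subrr.
have onN s u : inspan A B (s *: N + u *: P) by apply/spN; exists s, u.
(* Otherwise [N] would be a second point of the line on the quadric. *)
have dN : \det N != 0.
  apply/eqP => d0; have [||c] := uniqP _ (onN 1 0); first exact: nz (oner_neq0 _).
    by rewrite det_comb d0 dP !mulr0 mul0r !addr0.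
  exact: notP (oner_neq0 _).
(* With [b = det_polar N P], the determinant of [b N - (det N) P] is [b^2 det N - b (det N) b = 0];
   for [b != 0] this is another point on the quadric. *)
have b0 : det_polar N P = 0.
  apply/eqP; apply: contraT => b0.
  have [||c] := uniqP _ (onN (det_polar N P) (- \det N)); first exact: nz.
    by rewrite det_comb dP; ring.
  by move=> /(notP _ _ _ b0).
have [c hc] := sqrtF _ dN.
have c0 : c != 0.
  by apply/eqP => c0; move/eqP: hc; rewrite c0 expr0n mul0r eq_sym oner_eq0.
(* [c] normalizes the determinant and the multiple of [P] clears the entry [i j]; adding it leaves
   the determinant unchanged because [det_polar N P] and [\det P] vanish. *)
exists (c *: N + (- (c * N i j / P i j)) *: P); split.
  by rewrite !mxE mulNr divfK // subrr.
split; first by rewrite det_comb dP b0 hc !mulr0 !addr0.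
split.
  have e (s u : F) : det_polar (s *: N + u *: P) P = s * det_polar N P + u * (\det P *+ 2).
    by rewrite /det_polar det2E !mxE; ring.
  by rewrite e b0 dP mul0rn !mulr0 addr0.
move=> X; rewrite spN; split=> -[s [u ->]]; apply: inspan_comb.
- set k := - _; rewrite [X in inspan _ _ X](_ : N =
      c^-1 *: (c *: N + k *: P) + (- (k / c)) *: P).
    by apply: inspan_comb; [exact: inspanl | exact: inspanr].
  rewrite scalerDr !scalerA mulVf // scale1r -addrA -scalerDl.
  by rewrite [k / c]mulrC subrr scale0r addr0.
- exact: inspanr.
- by apply: inspan_comb; [exact: inspanl | exact: inspanr].
- exact: inspanr.
Qed.

End FieldLines.

(** * Continuity of the normalized section *)

Definition normsq (R : realType) (z : R[i]) : R :=
  complex.Re z ^+ 2 + complex.Im z ^+ 2.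

Lemma normsqM (R : realType) (x y : R[i]) : normsq (x * y) = normsq x * normsq y.
Proof. by case: x => a b; case: y => c d; rewrite /normsq /=; ring. Qed.

Lemma normsqD (R : realType) (x y : R[i]) :
  normsq (x + y) <= 2 * normsq x + 2 * normsq y.
Proof.
case: x => a b; case: y => c d; rewrite /normsq /=.
by have := sqr_ge0 (a - c); have := sqr_ge0 (b - d); nra.
Qed.

Lemma normsq_ge0 (R : realType) (x : R[i]) : 0 <= normsq x.
Proof. by rewrite addr_ge0 ?sqr_ge0. Qed.

Lemma normsq_eq0 (R : realType) (x : R[i]) : (normsq x == 0) = (x == 0).
Proof.
by case: x => a b; rewrite paddr_eq0 ?sqr_ge0 // !sqrf_eq0 eq_complex.
Qed.

Lemma normsqR (R : realType) (a : R) : normsq a%:C = a ^+ 2.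
Proof. by rewrite /normsq /= expr0n addr0. Qed.

Lemma nrm2Z (R : realType) (x : R[i]) (B : 'M[R[i]]_2) :
  nrm2 (x *: B) = normsq x * nrm2 B.
Proof.
rewrite /nrm2 mulr_sumr; apply: eq_bigr => i _; rewrite mulr_sumr.
by apply: eq_bigr => j _; rewrite mxE -!/(normsq _) normsqM.
Qed.

Lemma nrm2D (R : realType) (A B : 'M[R[i]]_2) :
  nrm2 (A + B) <= 2 * nrm2 A + 2 * nrm2 B.
Proof.
rewrite /nrm2 !mulr_sumr -big_split; apply: ler_sum => i _ /=.
rewrite !mulr_sumr -big_split; apply: ler_sum => j _ /=.
by rewrite mxE -!/(normsq _) normsqD.
Qed.

Lemma normsq_entry (R : realType) (B : 'M[R[i]]_2) i j : normsq (B i j) <= nrm2 B.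
Proof.
rewrite /nrm2 (bigD1 i) //= (bigD1 j) //= -!/(normsq _) -addrA lerDl.
apply: addr_ge0; first by apply: sumr_ge0 => k _; apply: normsq_ge0.
by apply: sumr_ge0 => k _; apply: sumr_ge0 => l _; apply: normsq_ge0.
Qed.

(** The map sending [z] to [|z|/z] is Lipschitz away from 0; this controls the phase by which a unit
    representative must be turned. *)
Lemma normsq_phase (R : realType) (L M : R[i]) : L != 0 -> M != 0 ->
  normsq ((Num.sqrt (normsq L))%:C / L - (Num.sqrt (normsq M))%:C / M)
    <= 4 * (normsq (L - M) / normsq L).
Proof.
move=> L0 M0; set r := Num.sqrt _; set s := Num.sqrt _.
have hr : r ^+ 2 = normsq L by rewrite sqr_sqrtr ?normsq_ge0.
have hs : s ^+ 2 = normsq M by rewrite sqr_sqrtr ?normsq_ge0.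
have r0 : 0 <= r by apply: sqrtr_ge0.
have s0 : 0 <= s by apply: sqrtr_ge0.
have L1 : 0 < normsq L by rewrite lt_def normsq_eq0 L0 normsq_ge0.
have M1 : 0 < normsq M by rewrite lt_def normsq_eq0 M0 normsq_ge0.
have -> : r%:C / L - s%:C / M = (r%:C * M - s%:C * L) * (L * M)^-1.
  by field; rewrite L0 M0.
have V (x : R[i]) : x != 0 -> normsq x^-1 = (normsq x)^-1.
  move=> x0; apply: (@mulfI _ (normsq x)); first by rewrite normsq_eq0.
  by rewrite -normsqM mulfV // mulfV ?normsq_eq0 // -[1]/(1%:C) normsqR expr1n.
rewrite normsqM V ?mulf_neq0 // normsqM ler_pdivrMr ?mulr_gt0 //.
have -> : 4 * (normsq (L - M) / normsq L) * (normsq L * normsq M) =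
  4 * normsq (L - M) * s ^+ 2 by rewrite hs; field; rewrite gt_eqF.
(* Each of the two summands has modulus at most [s |L - M|], the first by the reverse triangle
   inequality. *)
have -> : r%:C * M - s%:C * L = (r - s)%:C * M + s%:C * (M - L).
  by rewrite rmorphB /=; ring.
apply: (le_trans (normsqD _ _)); rewrite !normsqM !normsqR.
have -> : normsq (M - L) = normsq (L - M).
  by rewrite -opprB; case: (L - M) => p q; rewrite /normsq /= !sqrrN.
suff h : (r - s) ^+ 2 <= normsq (L - M).
  rewrite -hs; have := ler_wpM2r (sqr_ge0 s) h; lra.
(* Cauchy-Schwarz in the plane, through Lagrange's identity. *)
have : r * s >= complex.Re L * complex.Re M + complex.Im L * complex.Im M.
  case: (lerP (complex.Re L * complex.Re M + complex.Im L * complex.Im M) 0) => [h|h].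
    by apply: (le_trans h); apply: mulr_ge0.
  rewrite -(@ler_pXn2r _ 2) ?nnegrE ?(ltW h) ?mulr_ge0 // exprMn hr hs /normsq.
  rewrite -subr_ge0.
  have -> : (complex.Re L ^+ 2 + complex.Im L ^+ 2) * (complex.Re M ^+ 2 + complex.Im M ^+ 2)
    - (complex.Re L * complex.Re M + complex.Im L * complex.Im M) ^+ 2 =
    (complex.Re L * complex.Im M - complex.Im L * complex.Re M) ^+ 2 by ring.
  exact: sqr_ge0.
move: hr hs; rewrite /normsq; clearbody r s; clear -r.
by case: L => a b; case: M => c d /=; nra.
Qed.

(** If [X'] is a unit representative of the complex class of [X], then [X'] times the phase
    [|phi X'|/phi X'] is a unit representative of the real class of [X / phi X]; matrix and phase
    both vary continuously. *)
Lemma rclose_normalized (R : realType) (phi : 'M[R[i]]_2 -> R[i]) (K : R)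
    (X : 'M[R[i]]_2) :
  scalar phi -> (forall Y, normsq (phi Y) <= K * nrm2 Y) -> phi X != 0 ->
  forall e : R, 0 < e -> exists d : R, 0 < d /\
    forall Y, phi Y != 0 -> cclose d X Y ->
      rclose e ((phi X)^-1 *: X) ((phi Y)^-1 *: Y).
Proof.
move=> lin bnd X0 e e0.
have phiZ c Y : phi (c *: Y) = c * phi Y.
  have phi0 : phi 0 = 0.
    by have := lin (-1) 0 0; rewrite scaler0 addr0 mulN1r addNr.
  by have := lin c Y 0; rewrite !addr0 phi0 addr0.
have phiB Y Y' : phi (Y - Y') = phi Y - phi Y'.
  by rewrite -scaleN1r addrC lin mulN1r addrC.
have nX : 0 < normsq (phi X) by rewrite lt_def normsq_eq0 X0 normsq_ge0.
have K0 : 0 < K * nrm2 X by apply: lt_le_trans nX (bnd X).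
have nX0 : 0 <= nrm2 X.
  by apply: le_trans (normsq_entry X 0 0); apply: normsq_ge0.
have nXp : 0 < nrm2 X.
  by rewrite lt_def nX0 andbT; apply/eqP => h; move: K0; rewrite h mulr0 ltxx.
have Kp : 0 < K by rewrite pmulr_lgt0 in K0.
(* The Lipschitz constant for squared distances: 2 from the change of matrix, and
   [2 * 4 * K / |phi X'|^2] from the change of phase. *)
pose T := 2 + 8 * K * (nrm2 X / normsq (phi X)).
have T2 : 2 <= T.
  by rewrite lerDl; apply: mulr_ge0; [apply: mulr_ge0|apply: divr_ge0]; rewrite ?ltW.
(* As [T >= 1], the resulting bound [T (e/T)^2 = e^2/T] is at most [e^2]. *)
exists (e / T); split; first by rewrite divr_gt0 //; lra.
move=> Y Y0 [_ [_ [[x [x0 ->]] [[y [y0 ->]] [nx [ny hd]]]]]].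
set X' := x *: X in nx hd *; set Y' := y *: Y in ny hd *.
have L0 : phi X' != 0 by rewrite phiZ mulf_neq0.
have M0 : phi Y' != 0 by rewrite phiZ mulf_neq0.
have sX : (phi X)^-1 *: X = (phi X')^-1 *: X'.
  by rewrite phiZ /X' scalerA; congr (_ *: _); field; rewrite X0 x0.
have sY : (phi Y)^-1 *: Y = (phi Y')^-1 *: Y'.
  by rewrite phiZ /Y' scalerA; congr (_ *: _); field; rewrite Y0 y0.
have pL : 0 < normsq (phi X') by rewrite lt_def normsq_eq0 L0 normsq_ge0.
have pM : 0 < normsq (phi Y') by rewrite lt_def normsq_eq0 M0 normsq_ge0.
have nL : normsq (phi X') = normsq (phi X) / nrm2 X.
  have -> : (nrm2 X)^-1 = normsq x.
    by apply: (@mulIf _ (nrm2 X)); rewrite ?gt_eqF // mulVf ?gt_eqF // -nrm2Z.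
  by rewrite phiZ normsqM mulrC.
clearbody X' Y'.
have unit_phase (z : R[i]) : z != 0 -> normsq ((Num.sqrt (normsq z))%:C / z) = 1.
  move=> z0; apply: (@mulIf _ (normsq z)); first by rewrite normsq_eq0.
  by rewrite -normsqM divfK // normsqR sqr_sqrtr ?normsq_ge0 // mul1r.
rewrite sX sY; set r := Num.sqrt (normsq (phi X')); set s := Num.sqrt (normsq (phi Y')).
have ur : normsq (r%:C / phi X') = 1 := unit_phase _ L0.
have us : normsq (s%:C / phi Y') = 1 := unit_phase _ M0.
have r0 : r != 0 by rewrite gt_eqF // sqrtr_gt0.
have s0 : s != 0 by rewrite gt_eqF // sqrtr_gt0.
exists (r%:C *: ((phi X')^-1 *: X')), (s%:C *: ((phi Y')^-1 *: Y')).
split; first by exists r.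
split; first by exists s.
rewrite !scalerA !nrm2Z ur us nx ny !mulr1; do 2! split=> //.
have -> : r%:C / phi X' *: X' - s%:C / phi Y' *: Y' =
  s%:C / phi Y' *: (X' - Y') + (r%:C / phi X' - s%:C / phi Y') *: X'.
  by rewrite scalerBr scalerBl [RHS]addrC addrA subrK.
apply: (le_lt_trans (nrm2D _ _)).
rewrite !nrm2Z us nx mul1r mulr1.
have h1 := normsq_phase L0 M0.
have h2 := bnd (X' - Y'); rewrite phiB in h2.
have h3 : 2 * nrm2 (X' - Y') + 2 * normsq (r%:C / phi X' - s%:C / phi Y')
    <= T * nrm2 (X' - Y').
  apply: (@le_trans _ _ (2 * nrm2 (X' - Y') + 2 * (4 * (K * nrm2 (X' - Y') / normsq (phi X'))))).
    rewrite lerD2l ler_pM2l //; apply: (le_trans h1); rewrite ler_pM2l //.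
    by rewrite ler_pM2r ?invr_gt0.
  rewrite nL /T le_eqVlt; apply/orP; left; apply/eqP; field.
  by rewrite !gt_eqF.
apply: (le_lt_trans h3).
have : T * nrm2 (X' - Y') < T * (e / T) ^+ 2 by rewrite ltr_pM2l //; lra.
move=> /lt_le_trans; apply.
have -> : T * (e / T) ^+ 2 = e ^+ 2 / T by field; rewrite gt_eqF //; lra.
by rewrite ler_pdivrMr; [rewrite ler_peMr ?sqr_ge0 //; lra | lra].
Qed.

(** * Leading terms of matrices *)

Definition tokmat (R : realType) (X : 'M[puiseux R]_2) : kmat R :=
  fun i j => X i j : puiseux R.

Lemma tokmat_inj (R : realType) : injective (@tokmat R).
Proof.
move=> X Y h; apply/matrixP => i j; apply: val_inj.
exact: (congr1 (fun A : kmat R => A i j) h).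
Qed.

Lemma tokmat_surj (R : realType) (A : kmat R) : is_kmat A ->
  exists X, A = tokmat X.
Proof.
move=> hA; exists (\matrix_(i, j) mkpuiseux (hA i j)).
by apply/funext => i; apply/funext => j; rewrite /tokmat mxE.
Qed.

Lemma kdet_tokmat (R : realType) (X : 'M[puiseux R]_2) :
  kdet (tokmat X) = \det X :> pser R.
Proof. by rewrite det2E. Qed.

Lemma klin_tokmat (R : realType) (s u : puiseux R) (X Y : 'M[puiseux R]_2) :
  klin s (tokmat X) u (tokmat Y) = tokmat (s *: X + u *: Y).
Proof. by apply/funext => i; apply/funext => j; rewrite /tokmat !mxE. Qed.

Lemma kscale_tokmat (R : realType) (c : puiseux R) (X : 'M[puiseux R]_2) :
  kscale c (tokmat X) = tokmat (c *: X).
Proof. by apply/funext => i; apply/funext => j; rewrite /tokmat !mxE. Qed.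

Lemma mkpuiseux_eq0 (R : realType) (a : pser R) (h : is_puiseux a) :
  (a = pzero R) <-> mkpuiseux h = 0.
Proof.
split=> [e|e]; first exact: val_inj.
by rewrite -[a]/(coefs (mkpuiseux h)) e.
Qed.

Lemma coefs_eq0 (R : realType) (a : puiseux R) :
  ((a : pser R) = pzero R) <-> a = 0.
Proof. by split=> [e|->] //; apply: val_inj. Qed.

Lemma kdet_eq0 (R : realType) (X : 'M[puiseux R]_2) :
  (kdet (tokmat X) = pzero R) <-> \det X = 0.
Proof. by rewrite kdet_tokmat coefs_eq0. Qed.

Lemma kdet_eq1 (R : realType) (X : 'M[puiseux R]_2) :
  (kdet (tokmat X) = pone R) <-> \det X = 1.
Proof. by rewrite kdet_tokmat; split=> [e|->] //; apply: val_inj. Qed.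

Lemma kindep_tokmat (R : realType) (X Y : 'M[puiseux R]_2) :
  kindep (tokmat X) (tokmat Y) -> lindep2 X Y.
Proof.
move=> h s u e; have := h s u (is_puiseuxP s) (is_puiseuxP u).
rewrite klin_tokmat e => -[|/coefs_eq0 -> /coefs_eq0 ->] //.
by apply/funext => i; apply/funext => j; rewrite /tokmat mxE.
Qed.

(** For independent generators, a pair of coefficients is nonzero exactly when the combination
    is. *)
Lemma konl_tokmat (R : realType) (X Y : 'M[puiseux R]_2) (Z : kmat R) :
  lindep2 X Y -> konl (tokmat X) (tokmat Y) Z <->
  exists W, Z = tokmat W /\ W != 0 /\ inspan X Y W.
Proof.
move=> ind; split=> [[s [u [hs [hu [su0 ->]]]]]|[W [-> [W0 [s [u eW]]]]]].
  exists (mkpuiseux hs *: X + mkpuiseux hu *: Y); rewrite -klin_tokmat; split=> //.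
  split; last by do 2! eexists.
  apply/eqP => /ind[/mkpuiseux_eq0 s0 /mkpuiseux_eq0 u0].
  by case: su0; rewrite ?s0 ?u0.
exists s, u; split; first exact: is_puiseuxP.
split; first exact: is_puiseuxP.
split; last by rewrite eW klin_tokmat.
apply: contrapT => /not_orP[/contrapT/coefs_eq0 s0 /contrapT/coefs_eq0 u0].
by case/eqP: W0; rewrite eW s0 u0 !scale0r addr0.
Qed.

Section Leading.
Variable R : realType.
Local Notation K := (puiseux R).
Implicit Types X Y : 'M[K]_2.

Definition cmat X (q : rat) : 'M[R[i]]_2 := lead_mat (tokmat X) q.

(** Only an upper bound, so the coefficient matrix at [q] may vanish. *)
Definition deg_le X (q : rat) := forall q', q < q' -> cmat X q' = 0.

Lemma cmatE X q i j : cmat X q i j = (X i j : K) q.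
Proof. by rewrite mxE. Qed.

Lemma deg_le_entry X al i j : deg_le X al ->
  forall q, al < q -> (X i j : K) q = 0.
Proof. by move=> hX q /hX/matrixP/(_ i j); rewrite cmatE mxE. Qed.

Lemma cmatD X Y q : cmat (X + Y) q = cmat X q + cmat Y q.
Proof. by apply/matrixP => i j; rewrite [RHS]mxE !cmatE mxE. Qed.

Lemma cmatN X q : cmat (- X) q = - cmat X q.
Proof. by apply/matrixP => i j; rewrite [RHS]mxE !cmatE mxE. Qed.

Lemma lead_expP X q :
  lead_exp (tokmat X) q <-> cmat X q != 0 /\ deg_le X q.
Proof.
split=> [[[i [j ij]] h]|[h1 h2]].
  split; first by apply: contraNneq ij => /matrixP/(_ i j); rewrite !mxE => ->.
  by move=> q' hq; apply/matrixP => k l; rewrite !mxE h.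
split; last first.
  by move=> i j q' /h2/matrixP/(_ i j); rewrite !mxE.
apply: contrapT => hn; case/eqP: h1; apply/matrixP => i j; rewrite !mxE.
by apply: contrapT => /eqP hij; apply: hn; exists i, j.
Qed.

Lemma lead_exp_uniq (A : kmat R) q q' : lead_exp A q -> lead_exp A q' -> q = q'.
Proof.
move=> [[i [j h]] hv] [[k [l h']] hv'].
case: (ltgtP q q') => // hq; first by move: h'; rewrite hv // eqxx.
by move: h; rewrite hv' // eqxx.
Qed.

Lemma lead_exp_exists X : X != 0 -> exists q, lead_exp (tokmat X) q.
Proof.
move=> X0.
pose s := [seq X p.1 p.2 | p <- enum {: 'I_2 * 'I_2}].
have Xs i j : X i j \in s.
  by apply: (map_f (fun p => X p.1 p.2) (x := (i, j))); rewrite mem_enum.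
have [|q [[a as_ aq] hq]] := @puiseux_lead R s.
  apply: contrapT => h; case/eqP: X0; apply/matrixP => i j; rewrite mxE.
  by apply: contrapT => /eqP hij; apply: h; exists (X i j).
exists q; split; last by move=> i j q'; apply: hq.
by have /mapP[p _ e] := as_; exists p.1, p.2; rewrite /tokmat -e.
Qed.

Lemma cmat_scale (u : K) X be al :
  (forall q, be < q -> u q = 0) -> deg_le X al ->
  cmat (u *: X) (be + al) = u be *: cmat X al /\ deg_le (u *: X) (be + al).
Proof.
move=> hu hX.
have h i j := pmul_lead (a := u) (b := X i j) hu
  (deg_le_entry i j hX).
split; first by apply/matrixP => i j; rewrite [RHS]mxE !cmatE mxE; case: (h i j).
by move=> q hq; apply/matrixP => i j; rewrite cmatE !mxE; case: (h i j) => _; apply.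
Qed.

Lemma det_lead X al : deg_le X al ->
  (\det X : K) (al + al) = \det (cmat X al) /\
  forall q, al + al < q -> (\det X : K) q = 0.
Proof.
move=> hX.
have h i j k l := pmul_lead (a := X i j) (b := X k l)
  (deg_le_entry i j hX)
  (deg_le_entry k l hX).
rewrite !det2E; split.
  rewrite !cmatE. case: (h ord0 ord0 ord_max ord_max) => [<- _].
  by case: (h ord0 ord_max ord_max ord0) => [<- _].
move=> q hq; case: (h ord0 ord0 ord_max ord_max) => [_ /(_ _ hq) e1].
case: (h ord0 ord_max ord_max ord0) => [_ /(_ _ hq) e2].
rewrite -[LHS]/(pmul (X ord0 ord0) (X ord_max ord_max) q -
  pmul (X ord0 ord_max) (X ord_max ord0) q).
by rewrite e1 e2 subr0.
Qed.

Lemma det_polar_lead X Y al be : deg_le X al -> deg_le Y be ->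
  (det_polar X Y : K) (al + be) = det_polar (cmat X al) (cmat Y be).
Proof.
move=> hX hY.
have h i j k l := pmul_lead (a := X i j) (b := Y k l)
  (deg_le_entry i j hX)
  (deg_le_entry k l hY).
rewrite /det_polar !cmatE.
case: (h ord0 ord0 ord_max ord_max) => [<- _].
case: (h ord_max ord_max ord0 ord0) => [<- _].
case: (h ord0 ord_max ord_max ord0) => [<- _].
by case: (h ord_max ord0 ord0 ord_max) => [<- _].
Qed.

End Leading.

(** * The image of the line *)

(* The sign records the choice of a square root of the determinant. *)
Definition VALset (R : realType) (al : rat) (N0 P0 : 'M[R[i]]_2) :
    set 'M[R[i]]_2 :=
  [set X | (exists l, l != 0 /\ X = l *: P0) \/
    (exists (b : bool) l, X = cone (ratr al) ((-1) ^+ b *: N0 + l *: P0)) \/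
    (exists (be : rat) l, al < be /\ l != 0 /\ X = cone (ratr be) (l *: P0))].

Section TangentLine.
Variables (R : realType).
Local Notation K := (puiseux R).
Variables (N P : 'M[K]_2) (al pi : rat) (i j : 'I_2).
Hypothesis Nij : N i j = 0.
Hypothesis leadN : lead_exp (tokmat N) al.
Hypothesis leadP : lead_exp (tokmat P) pi.
Hypothesis Pij : (P i j : K) pi != 0.
Hypothesis detN : \det N = 1.
Hypothesis bilNP : det_polar N P = 0.
Hypothesis detP : \det P = 0.

Let N0 := cmat N al.
Let P0 := cmat P pi.

Lemma lead_entries : N0 i j = 0 /\ P0 i j != 0.
Proof. by rewrite !cmatE Nij. Qed.

Lemma cindep_lead : cindep N0 P0.
Proof.
move=> s u h; have [n0 p0] := lead_entries.
have u0 : u = 0.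
  have := congr1 (fun M : 'M[R[i]]_2 => M i j) h.
  rewrite [LHS]mxE [X in X + _]mxE [X in _ + X]mxE [RHS]mxE => /eqP.
  by rewrite n0 mulr0 add0r mulf_eq0 (negbTE p0) orbF => /eqP.
split=> //; apply/eqP; move/eqP: h; rewrite u0 scale0r addr0 scaler_eq0.
by case/orP=> // /eqP N00; have [/eqP] := (lead_expP N al).1 leadN.
Qed.

(** For [al < 0] all exponents of [\det N] would be negative, whereas [\det N = 1] has exponent
    0. *)
Lemma lead_ge0 : 0 <= al.
Proof.
have [_ dN] := (lead_expP N al).1 leadN.
rewrite leNgt; apply/negP => al0; have [_ /(_ 0)] := det_lead dN.
rewrite detN -[(1 : K) 0]/(pone R 0) /pone eqxx => h.
have al2 : al + al < 0 by lra.
by have /eqP := h al2; rewrite oner_eq0.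
Qed.

(** These are the coefficients of [\det N = 1], [det_polar N P = 0] and [\det P = 0] at [al + al],
    [al + pi] and [pi + pi]. *)
Lemma det_lead_line : \det N0 = (al == 0)%:R /\ det_polar N0 P0 = 0 /\ \det P0 = 0.
Proof.
have [_ dN] := (lead_expP N al).1 leadN.
have [_ dP] := (lead_expP P pi).1 leadP.
have [<- _] := det_lead dN; have [<- _] := det_lead dP.
rewrite -(det_polar_lead dN dP) detN bilNP detP; split=> //.
by rewrite -[LHS]/(pone R (al + al)) /pone -mulr2n mulrn_eq0.
Qed.

Lemma cmat_sign (b : bool) q : cmat ((-1) ^+ b *: N) q = (-1) ^+ b *: cmat N q.
Proof. by case: b; rewrite ?scaleN1r ?cmatN ?scale1r. Qed.

Lemma lead_comb_low (b : bool) (u : K) :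
  (forall q, al - pi < q -> u q = 0) ->
  lead_exp (tokmat ((-1) ^+ b *: N + u *: P)) al /\
  cmat ((-1) ^+ b *: N + u *: P) al = (-1) ^+ b *: N0 + u (al - pi) *: P0.
Proof.
move=> hu; have [_ dN] := (lead_expP N al).1 leadN.
have [_ dP] := (lead_expP P pi).1 leadP.
have [e1 e2] := cmat_scale hu dP; rewrite subrK in e1 e2.
have e : cmat ((-1) ^+ b *: N + u *: P) al = (-1) ^+ b *: N0 + u (al - pi) *: P0.
  by rewrite cmatD cmat_sign e1.
split=> //; apply/lead_expP; split; last first.
  by move=> q hq; rewrite cmatD cmat_sign dN // e2 // scaler0 addr0.
(* Independence of [N0] and [P0] rules out cancellation at [t^al]. *)
rewrite e; apply/eqP => /cindep_lead[/eqP].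
by rewrite signr_eq0.
Qed.

Lemma lead_comb_high (b : bool) (u : K) be : al - pi < be ->
  u be != 0 -> (forall q, be < q -> u q = 0) ->
  lead_exp (tokmat ((-1) ^+ b *: N + u *: P)) (be + pi) /\
  cmat ((-1) ^+ b *: N + u *: P) (be + pi) = u be *: P0.
Proof.
move=> hbe ub hu; have [_ dN] := (lead_expP N al).1 leadN.
have [P00 dP] := (lead_expP P pi).1 leadP.
have [e1 e2] := cmat_scale hu dP.
have habe : al < be + pi by rewrite -ltrBlDr.
have e : cmat ((-1) ^+ b *: N + u *: P) (be + pi) = u be *: P0.
  by rewrite cmatD cmat_sign dN // scaler0 add0r e1.
split=> //; apply/lead_expP; split; first by rewrite e scaler_eq0 negb_or ub.
by move=> q hq; rewrite cmatD cmat_sign dN ?(lt_trans habe) // e2 // scaler0 addr0.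
Qed.

Lemma lead_comb (b : bool) (u : K) ga :
  lead_exp (tokmat ((-1) ^+ b *: N + u *: P)) ga ->
  (ga = al /\ exists l, cmat ((-1) ^+ b *: N + u *: P) ga = (-1) ^+ b *: N0 + l *: P0)
  \/ (al < ga /\ exists l, l != 0 /\ cmat ((-1) ^+ b *: N + u *: P) ga = l *: P0).
Proof.
move=> hga; case: (pselect (forall q, al - pi < q -> u q = 0)) => [hu|].
  have [h e] := lead_comb_low b hu; left; have eg := lead_exp_uniq hga h.
  by split=> //; exists (u (al - pi)); rewrite eg.
move=> /existsNP[q /not_implyP[hq /eqP uq]]; right.
have [|be [ube hbe]] := @puiseux_lead1 R u.
  by apply: contraNneq uq => ->.
have qbe : q <= be.
  by rewrite leNgt; apply: contra uq => /hbe ->.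
have [|h e] := lead_comb_high b (lt_le_trans hq qbe) ube.
  exact: hbe.
have eg := lead_exp_uniq hga h.
split; first by rewrite eg -ltrBlDr (lt_le_trans hq).
by exists (u be); rewrite eg.
Qed.

Variables A1 A2 : 'M[K]_2.
Hypothesis ind : lindep2 A1 A2.
Hypothesis spanE : forall X, inspan A1 A2 X <-> inspan N P X.

Lemma det_line s u : \det (s *: N + u *: P) = s ^+ 2.
Proof. by rewrite det_comb detN bilNP detP; ring. Qed.

Lemma VALline_set : VALline (tokmat A1) (tokmat A2) = VALset al N0 P0.
Proof.
have [P00 dP] := (lead_expP P pi).1 leadP.
apply/seteqP; split=> X.
  move=> [_ [/(konl_tokmat _ ind)[W [-> [W0 /spanE[s [u eW]]]]]]].
  case=> [[/kdet_eq0 d0 [ga [hga ->]]]|[_ [c [ga [hc [hd [hga ->]]]]]]].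
    (* The determinant on the line is [s^2], so a point on the quadric is a multiple of [P]. *)
    have s0 : s = 0 by apply/eqP; rewrite -sqrf_eq0 -(det_line s u) -eW d0.
    rewrite s0 scale0r add0r in eW.
    have u0 : u != 0 by apply: contraNneq W0 => u0; rewrite eW u0 scale0r.
    have [be [ube hbe]] := puiseux_lead1 u0.
    have [e1 e2] := cmat_scale hbe dP.
    left; exists (u be); split=> //.
    have h : lead_exp (tokmat W) (be + pi).
      by apply/lead_expP; rewrite eW; split=> //; rewrite e1 scaler_eq0 negb_or ube.
    by rewrite (lead_exp_uniq hga h) -/(cmat W _) eW e1.
  right; pose cK : K := mkpuiseux hc.
  have eA : kscale c (tokmat W) = tokmat (cK *: W) by rewrite -kscale_tokmat.
  rewrite eA in hd hga *; move/kdet_eq1: hd.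
  (* Rescaling to determinant 1 forces [(c s)^2 = 1], so the coefficient of [N] becomes a sign. *)
  rewrite eW scalerDr !scalerA det_line in hga * => /eqP; rewrite sqrf_eq1 => hs.
  have [b eb] : exists b : bool, cK * s = (-1) ^+ b.
    by case/orP: hs => /eqP ->; [exists false | exists true].
  rewrite eb in hga *; case: (lead_comb hga) => [[ega [l e]]|[ega [l [l0 e]]]].
    by left; exists b, l; rewrite -/(cmat _ _) e ega.
  by right; exists ga, l; rewrite -/(cmat _ _) e.
have onW (s u : K) : (s != 0) || (u != 0) ->
    konl (tokmat A1) (tokmat A2) (tokmat (s *: N + u *: P)).
  move=> su; apply/(konl_tokmat _ ind); exists (s *: N + u *: P); split=> //.
  split; last by apply/spanE; exists s, u.
  apply: contraTneq su => e; have s0 : s = 0.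
    by apply/eqP; rewrite -sqrf_eq0 -(det_line s u) e det2E !mxE; apply/eqP; ring.
  move/eqP: e; rewrite s0 eqxx /= scale0r add0r scaler_eq0 negbK => /orP[] //.
  by move=> /eqP eP; move: Pij; rewrite eP mxE eqxx.
have val1 (b : bool) (u : K) ga : lead_exp (tokmat ((-1) ^+ b *: N + u *: P)) ga ->
    VALline (tokmat A1) (tokmat A2)
      (cone (ratr ga) (cmat ((-1) ^+ b *: N + u *: P) ga)).
  move=> hga; eexists; split; first by apply: (onW ((-1) ^+ b) u); rewrite signr_eq0.
  right; split.
    by move=> /kdet_eq0/eqP; rewrite det_line sqrr_sign oner_eq0.
  have e1 : kscale (pone R) (tokmat ((-1) ^+ b *: N + u *: P)) =
      tokmat ((-1) ^+ b *: N + u *: P).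
    by rewrite -[pone R]/(coefs (1 : K)) kscale_tokmat scale1r.
  exists (pone R), ga; rewrite e1; split; first exact: pone_puiseux.
  by split=> //; apply/kdet_eq1; rewrite det_line sqrr_sign.
(* Each element is attained with a monomial coefficient of [P]: [l], [l t^(al - pi)] or
   [l t^(be - pi)]. *)
case=> [[l [l0 ->]]|[[b [l ->]]|[be [l [hbe [l0 ->]]]]]].
- have [|e1 e2] := @cmat_scale _ (monK l 0) P 0 pi _ dP.
    by move=> q; rewrite monKE; case: eqP => // ->; rewrite ltxx.
  have ml : monK l 0 != 0.
    by apply: contraNneq l0 => /(congr1 (fun a : K => a 0)); rewrite monKE eqxx => ->.
  have e : 0 *: N + monK l 0 *: P = monK l 0 *: P by rewrite scale0r add0r.
  exists (tokmat (monK l 0 *: P)); split; first by rewrite -e; apply: onW; rewrite ml orbT.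
  left; split; first by apply/kdet_eq0; rewrite -e det_line expr0n.
  exists (0 + pi); split; last by rewrite -/(cmat _ _) e1 monKE eqxx.
  by apply/lead_expP; split=> //; rewrite e1 monKE eqxx scaler_eq0 negb_or l0.
- have [|h e] := lead_comb_low b (u := monK l (al - pi)).
    by move=> q; rewrite monKE; case: eqP => // ->; rewrite ltxx.
  by have := val1 _ _ _ h; rewrite e monKE eqxx.
- have [|||h e] := lead_comb_high false (u := monK l (be - pi)) (be := be - pi).
  + by rewrite ltrD2r.
  + by rewrite monKE eqxx.
  + by move=> q; rewrite monKE; case: eqP => // ->; rewrite ltxx.
  by have := val1 _ _ _ h; rewrite e monKE eqxx subrK.
Qed.

End TangentLine.

(** * Comparison with the two model sets *)

Lemma coneN (R : realType) a (B : 'M[R[i]]_2) : cone a (- B) = - cone a B.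
Proof.
rewrite /cone /ctr.
have -> : \adj (- B) = - \adj B.
  by apply/matrixP => k l; rewrite [RHS]mxE ![(\adj _) _ _]mxE !cofactor2 mxE mulrN.
by rewrite map_mxN [trmx _]linearN /= !scalerN opprD.
Qed.

Lemma cone_sign (R : realType) a (b : bool) (B : 'M[R[i]]_2) :
  cone a ((-1) ^+ b *: B) = (-1) ^+ b *: cone a B.
Proof. by case: b; rewrite ?scaleN1r ?coneN ?scale1r. Qed.

Section Models.
Variables (R : realType) (N P : 'M[R[i]]_2).
Hypothesis indNP : cindep N P.

Lemma onl_not_cprop Y : onl N P Y -> ~ cprop P Y ->
  exists s u, s != 0 /\ Y = s *: N + u *: P.
Proof.
move=> [s [u [su ->]]] nP; exists s, u; split=> //.
apply/eqP => s0; apply: nP; exists u; rewrite s0 scale0r add0r; split=> //.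
by case: su => //; rewrite s0 eqxx.
Qed.

Lemma comb_not_cprop s u : s != 0 -> ~ cprop P (s *: N + u *: P).
Proof.
move=> s0 [l [_ e]]; case/eqP: s0; apply: (proj1 (indNP (u := u - l) _)).
by rewrite scalerBl addrA e subrr.
Qed.

Lemma onl_comb s u : s != 0 -> onl N P (s *: N + u *: P).
Proof. by move=> s0; exists s, u; split=> //; left. Qed.

Lemma cls_sub (S T : set 'M[R[i]]_2) :
  (forall X, S X -> cls T X) -> cls S `<=` cls T.
Proof.
move=> h _ [Y [l [SY [l0 ->]]]]; have [Z [m [TZ [m0 ->]]]] := h _ SY.
by exists Z, (l * m); rewrite mulf_neq0 // scalerA.
Qed.

(** Dividing by [phi] makes the coefficient of [N] equal to 1. The sign in [VALset] comes out of the
    cone and disappears in the projective class. *)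
Lemma cls_model_i al (phi : 'M[R[i]]_2 -> R[i]) :
  (forall s u, phi (s *: N + u *: P) = s) ->
  cls (VALset al N P) =
  cls (model_i (ratr al) N P P (fun Y => (phi Y)^-1 *: Y)).
Proof.
move=> hphi; apply/seteqP; split; apply: cls_sub => X.
  case=> [[l [l0 ->]]|[[b [l ->]]|[be [l [hbe [l0 ->]]]]]].
  - by exists P, l; split=> //; right.
  - exists (cone (ratr al) (1 *: N + ((-1) ^+ b * l) *: P)), ((-1) ^+ b).
    split; last first.
      rewrite signr_eq0 -cone_sign scalerDr !scalerA mulr1 mulrA -expr2 sqrr_sign.
      by rewrite mul1r.
    left; left; exists (1 *: N + ((-1) ^+ b * l) *: P).
    split; first exact: onl_comb (oner_neq0 _).
    split; first exact: comb_not_cprop (oner_neq0 _).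
    by rewrite hphi invr1 !scale1r.
  - exists (cone (ratr be) (l *: P)), 1; rewrite oner_neq0 scale1r; split=> //.
    by left; right; exists be, l; rewrite ltr_rat.
suff h : forall X, model_i (ratr al) N P P (fun Y => (phi Y)^-1 *: Y) X ->
    VALset al N P X.
  by move=> hX; exists X, 1; rewrite oner_neq0 scale1r; split=> //; apply: h.
move=> {}X [[[Y [onY [nY ->]]]|[be [l [hbe [l0 ->]]]]]|->].
- have [s [u [s0 ->]]] := onl_not_cprop onY nY; right; left; exists false, (s^-1 * u).
  by rewrite hphi scalerDr !scalerA mulVf.
- by right; right; exists be, l; rewrite ltr_rat in hbe.
- by left; exists 1; rewrite oner_neq0 scale1r.
Qed.

Lemma cone0 (B : 'M[R[i]]_2) : cone (ratr 0) B = B + ctr (\adj B).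
Proof. by rewrite /cone rmorph0 oppr0 expR0 !scale1r. Qed.

Lemma cls_model_ii : \det N = 1 -> det_polar N P = 0 -> \det P = 0 ->
  cls (VALset 0 N P) = cls (model_ii N P P).
Proof.
move=> dN bNP dP.
have dcomb s u : \det (s *: N + u *: P) = s ^+ 2.
  by rewrite det_comb dN bNP dP; ring.
apply/seteqP; split; apply: cls_sub => X.
  case=> [[l [l0 ->]]|[[b [l ->]]|[be [l [hbe [l0 ->]]]]]].
  - by exists P, l; split=> //; right.
  - exists (cone (ratr 0) ((-1) ^+ b *: N + l *: P)), 1.
    rewrite oner_neq0 scale1r; split=> //; left; left.
    exists ((-1) ^+ b *: N + l *: P).
    split; first by apply: onl_comb; rewrite signr_eq0.
    split; first by apply: comb_not_cprop; rewrite signr_eq0.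
    by exists 1; rewrite dcomb sqrr_sign expr1n mulr1 scale1r cone0.
  - exists (cone (ratr be) (l *: P)), 1; rewrite oner_neq0 scale1r; split=> //.
    by left; right; exists be, l.
suff h : forall X, model_ii N P P X -> VALset 0 N P X.
  by move=> hX; exists X, 1; rewrite oner_neq0 scale1r; split=> //; apply: h.
move=> {}X [[[Y [onY [nY [c [hc ->]]]]]|[be [l [hbe [l0 ->]]]]]|->].
- have [s [u [s0 eY]]] := onl_not_cprop onY nY.
  (* The scalar [c] of the coamoeba map satisfies [(c s)^2 = 1], which is the sign of [VALset]. *)
  move/eqP: hc; rewrite eY dcomb -exprMn sqrf_eq1 => hs.
  have [b eb] : exists b : bool, c * s = (-1) ^+ b.
    by case/orP: hs => /eqP ->; [exists false | exists true].
  by right; left; exists b, (c * u); rewrite scalerDr !scalerA eb cone0.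
- by right; right; exists be, l.
- by left; exists 1; rewrite oner_neq0 scale1r.
Qed.

(** The entry [i j] reads off the coefficient of [P], and an entry where [N] is nonzero then gives
    that of [N]. This extends the coordinate to all matrices, with an explicit bound. *)
Lemma dual_coordinate (i j : 'I_2) : N i j = 0 -> P i j != 0 ->
  exists (phi : 'M[R[i]]_2 -> R[i]) (K : R), scalar phi /\
    (forall Y, normsq (phi Y) <= K * nrm2 Y) /\
    forall s u, phi (s *: N + u *: P) = s.
Proof.
move=> Nij Pij.
have [k [m Nkm]] : exists k m, N k m != 0.
  apply: contrapT => h.
  have N0 : N = 0.
    apply/matrixP => k m; rewrite mxE; apply: contrapT => /eqP hkm.
    by apply: h; exists k, m.
  have [|/eqP] := indNP (s := 1) (u := 0); first by rewrite N0 scaler0 scale0r addr0.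
  by rewrite oner_eq0.
pose x := (N k m)^-1; pose y := - (P k m / P i j / N k m).
exists (fun Y => x * Y k m + y * Y i j), (2 * normsq x + 2 * normsq y); split.
  by move=> a Y Z; rewrite !mxE; ring.
split=> [Y|s u]; last first.
  by rewrite !mxE Nij /x /y; field; rewrite Nkm Pij.
apply: (le_trans (normsqD _ _)); rewrite !normsqM [leRHS]mulrDl -!mulrA.
by apply: lerD; rewrite ler_pM2l // ler_wpM2l ?normsq_ge0 ?normsq_entry.
Qed.

Lemma is_section_normalized (phi : 'M[R[i]]_2 -> R[i]) (K : R) :
  scalar phi -> (forall Y, normsq (phi Y) <= K * nrm2 Y) ->
  (forall s u, phi (s *: N + u *: P) = s) ->
  is_section [set Y | onl N P Y /\ ~ cprop P Y] (fun Y => (phi Y)^-1 *: Y).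
Proof.
move=> lin bnd hphi.
have phi0 Y : onl N P Y /\ ~ cprop P Y -> phi Y != 0.
  by case=> h1 h2; have [s [u [s0 ->]]] := onl_not_cprop h1 h2; rewrite hphi.
split; first by move=> X /phi0 hX; exists (phi X)^-1; rewrite invr_eq0.
split.
  (* [X / phi X] is invariant under complex scaling, so the two values coincide. *)
  move=> X Y /phi0 hX /phi0 hY [l [l0 eY]]; exists 1; split; first exact: oner_neq0.
  have phiZ : phi Y = l * phi X.
    have phi00 : phi 0 = 0 by rewrite -[0](_ : 0 *: N + 0 *: P = 0) ?hphi // !scale0r addr0.
    by have := lin l X 0; rewrite !addr0 phi00 addr0 eY.
  rewrite phiZ eY scale1r scalerA; congr (_ *: _); field.
  by rewrite l0 hX.
move=> X /phi0 hX e e0; have [d [d0 hd]] := rclose_normalized lin bnd hX e0.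
by exists d; split=> // Y /phi0 hY; apply: hd.
Qed.

End Models.

Unset Implicit Arguments.

Theorem theorem4p1 (R : realType) (A1 A2 : kmat R) :
  is_kmat A1 -> is_kmat A2 -> kindep A1 A2 ->
  (* L cap Q(K) is a single point *)
  (exists P, konl A1 A2 P /\ kdet P = pzero R /\
     forall X, konl A1 A2 X -> kdet X = pzero R -> kprop P X) ->
  (exists (r : R) (B1 B2 P : 'M[R[i]]_2) (sigma : 'M[R[i]]_2 -> 'M[R[i]]_2),
     0 < r /\ cindep B1 B2 /\ (forall Y, onl B1 B2 Y -> \det Y = 0) /\
     onl B1 B2 P /\
     is_section [set Y | onl B1 B2 Y /\ ~ cprop P Y] sigma /\
     cls (VALline A1 A2) = cls (model_i r B1 B2 P sigma))
  \/
  (exists (B1 B2 P : 'M[R[i]]_2),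
     cindep B1 B2 /\ tangent_at B1 B2 P /\
     (exists Y, onl B1 B2 Y /\ \det Y != 0) /\
     cls (VALline A1 A2) = cls (model_ii B1 B2 P)).
Proof.
move=> /tokmat_surj[X1 ->] /tokmat_surj[X2 ->] /kindep_tokmat ind.
move=> [_ [/(konl_tokmat _ ind)[P [-> [P0 spP]]] [/kdet_eq0 dP uniqP]]].
have {}uniqP X : inspan X1 X2 X -> X != 0 -> \det X = 0 -> exists c, X = c *: P.
  move=> sX X0 /kdet_eq0 dX; have [|c [hc [_ e]]] := uniqP _ _ dX.
    by apply/(konl_tokmat _ ind); exists X.
  by exists (mkpuiseux hc); apply: tokmat_inj; rewrite -kscale_tokmat.
have [pi leadP] := lead_exp_exists P0.
have [[i [j Pij]] _] := leadP.
have Pij0 : P i j != 0 by apply: contraNneq Pij; rewrite /tokmat => ->.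
have [N [Nij [dN [bNP spE]]]] :=
  tangent_normal_form (@puiseux_invsqrt R) ind spP Pij0 dP uniqP.
have N0 : N != 0.
  by apply: contra_eqN dN => /eqP ->; rewrite det2E !mxE mulr0 subr0 eq_sym oner_eq0.
have [al leadN] := lead_exp_exists N0.
have [n0 p0] := lead_entries al Nij Pij.
have indC := cindep_lead Nij leadN Pij.
have [dN0 [b0 dP0]] := det_lead_line leadN leadP dN bNP dP.
rewrite (VALline_set Nij leadN leadP Pij dN bNP dP ind spE).
set NC := cmat N al in indC dN0 b0 n0 *; set PC := cmat P pi in indC b0 dP0 p0 *.
have onP : onl NC PC PC.
  by exists 0, 1; rewrite scale0r scale1r add0r; split=> //; right; apply: oner_neq0.
(* For [al = 0] the leading matrix of [N] has determinant 1, so the limit line is tangent without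
   lying in the quadric; for [al > 0] all three coefficients of the determinant vanish on it. *)
have [al0|al0] := eqVneq al 0.
  right; exists NC, PC, PC; rewrite al0 eqxx in dN0 *; split=> //; split.
    split=> //; split=> // _ [s [u [_ ->]]]; rewrite mxtrace_adj_polar.
    have -> : det_polar (s *: NC + u *: PC) PC = s * det_polar NC PC + u * (\det PC *+ 2).
      by rewrite /det_polar det2E !mxE; ring.
    by rewrite b0 dP0 mul0rn !mulr0 addr0.
  split; last exact: cls_model_ii.
  exists NC; rewrite dN0 oner_neq0; split=> //.
  by exists 1, 0; rewrite scale0r scale1r addr0; split=> //; left; apply: oner_neq0.
have [phi [K [lin [bnd hphi]]]] := dual_coordinate indC n0 p0.
left; exists (ratr al), NC, PC, PC, (fun Y => (phi Y)^-1 *: Y).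
split; first by rewrite ltr0q lt_def al0 (lead_ge0 leadN dN).
split=> //; split.
  move=> _ [s [u [_ ->]]].
  by rewrite det_comb dN0 (negbTE al0) b0 dP0 !mulr0 !addr0.
split=> //; split; last exact: cls_model_i.
exact: is_section_normalized lin bnd hphi.
Qed.
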